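(* Let $K_1,K_2$ be infinite compact spaces and $E_1,E_2$ Banach spaces, with $E_2$ not containing an isomorphic copy of $c_0$. (i) If $l,k\in\mathbb{N}$, $l>k$, $ht(K_1)=l$, $ht(K_2)=k$, and there exists an into isomorphism $T:\mathcal{C}(K_1,E_1)\to\mathcal{C}(K_2,E_2)$, then $$\|T\|\,\|T^{-1}\|\ \ge\ \max\left\{3,\ \frac{2l-k-1}{k-1}\right\}.$$ (ii) If $\mathcal{C}(K_1,E_1)$ embeds isomorphically into $\mathcal{C}(K_2,E_2)$ and $ht(K_2)$ is finite, then $ht(K_1)$ is finite.
   Context: All topological spaces are Hausdorff; all Banach spaces are real and of dimension at least $1$. For a compact space $K$ and a Banach space $E$, $\mathcal{C}(K,E)$ is the space of continuous functions $K\to E$ with the norm $\|f\|=\sup_{x\in K}\|f(x)\|$. For a topological space $S$, $S^{(0)}=S$, $S^{(1)}$ is the set of accumulation points of $S$, $S^{(\beta+1)}=(S^{(\beta)})^{(1)}$, and $S^{(\alpha)}=\bigcap_{\beta<\alpha}S^{(\beta)}$ for limit ordinals $\alpha$. $S$ is scattered if $S^{(\alpha)}=\emptyset$ for some ordinal $\alpha$, and the least such $\alpha$ is the height $ht(S)$. Thus ''$ht(S)=l$'' includes that $S$ is scattered, and ''$ht(S)$ is finite'' means that $S^{(j)}=\emptyset$ for some finite $j$. An into isomorphism is a linear map that is an isomorphism onto its range (not necessarily surjective), and $T^{-1}$ is then defined on the range of $T$. *)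

(* Defs.v *)
From HB Require Import structures.
From mathcomp Require Import all_boot all_order all_algebra.
From mathcomp Require Import all_classical all_reals all_analysis.

Set Implicit Arguments.
Unset Strict Implicit.
Unset Printing Implicit Defensive.

Import Order.TTheory GRing.Theory Num.Theory.
Import numFieldNormedType.Exports.

Local Open Scope classical_set_scope.
Local Open Scope ring_scope.

(* A linear space of bounded functions [X -> V]. It is turned below into a
   normed space by means of the supremum norm; both C(K, E) and c_0 are obtained
   in this way. *)
Record bounded_submod (R : realType) (X : Type) (V : normedModType R) :=
  BoundedSubmod {
    bsm_pred :> {pred X -> V};
    bsm_closed : submod_closed bsm_pred;
    bsm_bounded : forall f, f \in bsm_pred -> exists M, forall x, `|f x| <= M }.

HB.instance Definition _ (R : realType) (X : Type) (V : normedModType R)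
    (F : bounded_submod X V) :=
  GRing.isSubmodClosed.Build R (X -> V) (bsm_pred F) (bsm_closed F).

Record supnorm_space (R : realType) (X : Type) (V : normedModType R)
  (F : bounded_submod X V) := SupnormSpace {
    sn_fun :> X -> V;
    sn_mem : sn_fun \in bsm_pred F }.
Arguments SupnormSpace {R X V F} sn_fun sn_mem.

Section supnorm_space.
Context (R : realType) (X : Type) (V : normedModType R) (F : bounded_submod X V).
Local Notation S := (supnorm_space F).

HB.instance Definition _ := [isSub for @sn_fun R X V F].
HB.instance Definition _ := gen_eqMixin S.
HB.instance Definition _ := gen_choiceMixin S.
HB.instance Definition _ := [SubChoice_isSubLmodule of S by <:].

Definition supnorm (f : S) : R := sup (range (fun x => `|f x|)).

Lemma supnorm_ub (f : S) x : `|f x| <= supnorm f.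
Proof.
apply: ub_le_sup; last by exists x.
by have [M fM] := bsm_bounded (sn_mem f); exists M => _ [y _ <-].
Qed.

Let supnorm_empty (f : S) : ~ ([set: X] !=set0) -> supnorm f = 0.
Proof.
move=> X0; have fX0 : range (fun x => `|f x|) = set0.
  by apply/seteqP; split => [t [x _ _]|//]; case: X0; exists x.
by rewrite /supnorm fX0 sup0.
Qed.

Lemma supnorm_ge0 (f : S) : 0 <= supnorm f.
Proof.
have [[x _]|/supnorm_empty->//] := pselect ([set: X] !=set0).
by rewrite (le_trans _ (supnorm_ub f x)).
Qed.

Lemma supnorm_le (f : S) c : 0 <= c -> (forall x, `|f x| <= c) -> supnorm f <= c.
Proof.
move=> c0 fc; have [[x _]|/supnorm_empty->//] := pselect ([set: X] !=set0).
by apply: ge_sup => [|_ [y _ <-]//]; exists `|f x|, x.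
Qed.

Let supnormD (f g : S) : supnorm (f + g) <= supnorm f + supnorm g.
Proof.
apply: supnorm_le => [|x]; first by rewrite addr_ge0 ?supnorm_ge0.
by apply: (le_trans (ler_normD _ _)); apply: lerD; exact: supnorm_ub.
Qed.

Let supnormZ (l : R) (f : S) : supnorm (l *: f) = `|l| * supnorm f.
Proof.
have le_Z (a : R) (g : S) : supnorm (a *: g) <= `|a| * supnorm g.
  apply: supnorm_le => [|x]; first by rewrite mulr_ge0 ?supnorm_ge0.
  have -> : (a *: g) x = a *: g x by [].
  by rewrite normrZ ler_wpM2l ?supnorm_ub.
have [->|l0] := eqVneq l 0.
  rewrite normr0 mul0r; apply/eqP; rewrite eq_le supnorm_ge0 andbT.
  by apply: (le_trans (le_Z _ _)); rewrite normr0 mul0r.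
apply/eqP; rewrite eq_le le_Z /=.
rewrite -ler_pdivlMl ?normr_gt0// -normfV.
by rewrite -{1}(scalerK l0 f) le_Z.
Qed.

Let supnorm0_eq0 (f : S) : supnorm f = 0 -> f = 0.
Proof.
move=> f0; apply/val_inj/funext => x; apply/eqP.
by rewrite -normr_le0 -f0 supnorm_ub.
Qed.

HB.instance Definition _ :=
  Lmodule_isNormed.Build R S supnormD supnormZ supnorm0_eq0.

End supnorm_space.

Section continuous_functions.
Context (R : realType) (K : topologicalType) (cK : compact [set: K])
  (E : normedModType R).

Definition continuous_pred : {pred K -> E} := mem [set f | continuous f].

Lemma continuous_pred_closed : submod_closed continuous_pred.
Proof.
split; first by apply/mem_set => x; exact: cst_continuous.
move=> a f g /set_mem/= fc /set_mem/= gc; apply/mem_set => x.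
by apply: (@cvgD _ E); [apply: cvgZr; exact: fc|exact: gc].
Qed.

Lemma continuous_pred_bounded f :
  f \in continuous_pred -> exists M, forall x, `|f x| <= M.
Proof.
move=> /set_mem/= fc.
have : compact (f @` [set: K]).
  by apply: continuous_compact => //; exact: continuous_subspaceT.
move=> /compact_bounded[M [_ fM]]; exists (M + 1) => x.
by apply: (fM (M + 1)); [rewrite ltrDl|exists x].
Qed.

Definition continuous_submod : bounded_submod K E :=
  BoundedSubmod continuous_pred_closed continuous_pred_bounded.

(* The space C(K, E); the compactness proof is a parameter because the supremum
   norm is a norm only when all the elements are bounded. *)
Definition Cspace := supnorm_space continuous_submod.

HB.instance Definition _ := NormedModule.on Cspace.

End continuous_functions.

Section c_zero.
Context (R : realType).

Definition cvg0_pred : {pred nat -> R^o} :=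
  mem [set u : nat -> R^o | u @ \oo --> (0 : R^o)].

Lemma cvg0_pred_closed : submod_closed cvg0_pred.
Proof.
split; first by apply/mem_set; exact: cvg_cst.
move=> a u v /set_mem/= u0 /set_mem/= v0; apply/mem_set => /=.
rewrite -[X in _ --> X](addr0 0) -[X in _ --> X + _](scaler0 _ a).
by apply: (@cvgD _ R^o); [exact: cvgZr|].
Qed.

Lemma cvg0_pred_bounded u :
  u \in cvg0_pred -> exists M, forall n, `|u n| <= M.
Proof.
move=> /set_mem/= u0.
have /cvg_seq_bounded[M [_ uM]] : cvgn u by apply/cvg_ex; exists 0.
by exists (M + 1) => n; apply: (uM (M + 1)) => //; rewrite ltrDl.
Qed.

Definition cvg0_submod : bounded_submod nat R^o :=
  BoundedSubmod cvg0_pred_closed cvg0_pred_bounded.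

Definition c0_space := supnorm_space cvg0_submod.

HB.instance Definition _ := NormedModule.on c0_space.

End c_zero.

Section isomorphisms.
Context (R : realType) (V W : normedModType R).

(* The norm of a linear map [g] whose domain is the linear subspace [D]. *)
Definition opnorm_on (A B : normedModType R) (D : set A) (g : A -> B) : R :=
  sup [set `|g x| | x in D `&` [set x | `|x| <= 1]].

Definition opnorm (T : V -> W) : R := opnorm_on [set: V] T.

(* For injective [T], only the values of [inverse_on_range T] on [range T] are
   meaningful. *)
Definition inverse_on_range (T : V -> W) : W -> V :=
  'pinv_(fun=> 0) [set: V] T.

Definition inverse_norm (T : V -> W) : R :=
  opnorm_on (range T) (inverse_on_range T).

Definition into_isomorphism (T : {linear V -> W}) : Prop :=
  [/\ continuous T, injective T
    & {within range T, continuous (inverse_on_range T)}].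

Definition embeds_isomorphically : Prop :=
  exists T : {linear V -> W}, into_isomorphism T.

End isomorphisms.

Arguments embeds_isomorphically {R} V W.

(* The accumulation points of [A] as a space with the subspace topology. *)
Definition derived_set (S : topologicalType) (A : set S) : set S :=
  A `&` limit_point A.

Definition cantor_bendixson (S : topologicalType) (n : nat) : set S :=
  iter n (@derived_set S) [set: S].
Arguments cantor_bendixson : clear implicits.

(* Only finite heights occur, so that iterating [derived_set] over the natural
   numbers suffices. *)
Definition has_height (S : topologicalType) (n : nat) : Prop :=
  cantor_bendixson S n = set0 /\
  forall m, (m < n)%N -> cantor_bendixson S m !=set0.

Definition finite_height (S : topologicalType) : Prop :=
  exists n, cantor_bendixson S n = set0.

(* Main.v *)
Require Import Defs.
From HB Require Import structures.
From mathcomp Require Import all_boot all_order all_algebra.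
From mathcomp Require Import all_classical all_reals all_analysis.
From mathcomp Require Import ring lra.

Set Implicit Arguments.
Unset Strict Implicit.
Unset Printing Implicit Defensive.

Import Order.TTheory GRing.Theory Num.Theory.
Import numFieldNormedType.Exports.

Local Open Scope classical_set_scope.
Local Open Scope ring_scope.

(* Tensoring with a unit vector of E1 reduces the theorem to an embedding S of
   C(K1, R) with |f| <= B |S f| and |S f| <= A |f|. Since E2 does not contain
   c_0, at a fixed point of K2 the images of pairwise disjoint functions of norm
   at most 1 cannot stay away from 0. So if K2^(k) is empty, one can descend through
   the derived sets of K1, starting from a point of K1^(n), and build nested
   bumps f_0 >= ... >= f_(n-1), each equal to 1 where the next one is nonzero,
   such that at every point of K2 fewer than k of the S f_i have norm at least
   eps (we call these active): each new bump is small at the finitely many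
   points of K2 where one more active function would be too many.
   - For n = k, let h = f_0 + 2 f_(k-1), of norm 3. If f_i is inactive at y,
     then S h is close at y to the image of f_0 - 2 f_i + 2 f_(k-1), of norm at
     most 1 (with small changes if i is 0 or k-1), so 3 <= B A in the limit.
   - For n = l-1, let h be the sum of the f_i with coefficients 1 for i < k-1
     and 2 for i >= k-1; its norm is 2l-k-1. If f_i is active at y and i >= k-1,
     some f_j with j < i is inactive, and f_j - 2 f_i has norm at most 1, whence
     2 |S f_i y| <= A + eps. Each of the at most k-1 active terms of S h thus
     contributes at most A + eps. *)

(** * Into isomorphisms and the norms of a map and its inverse *)

Lemma inverse_on_rangeK (R : realType) (V W : normedModType R) (T : V -> W) :
  injective T -> cancel T (inverse_on_range T).
Proof.
move=> Tinj x; rewrite /inverse_on_range.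
by rewrite (@pinvKV _ _ (fun=> 0) [set: V] T) ?inE// => a b _ _; exact: Tinj.
Qed.

(** The lower bound makes [T] injective and its inverse on the range Lipschitz with constant
    [1 / c]. *)
Lemma bounded_below_into_isomorphism (R : realType) (V W : normedModType R)
    (T : {linear V -> W}) (C c : R) : 0 < c ->
  (forall x, `|T x| <= C * `|x|) -> (forall x, c * `|x| <= `|T x|) ->
  into_isomorphism T.
Proof.
move=> c0 TC Tc.
have Tinj : injective T.
  move=> x y Txy; apply/eqP; rewrite -subr_eq0 -normr_le0.
  by rewrite -(pmulr_rle0 _ c0) (le_trans (Tc _))// linearB Txy subrr normr0.
split=> //.
  apply: bounded_linear_continuous; apply/linear_boundedP.
  exists C; split; first exact: num_real.
  by move=> r /ltW Cr x; rewrite (le_trans (TC x))// ler_wpM2r.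
apply/subspace_continuousP => _ [x _ <-].
rewrite /from_subspace inverse_on_rangeK//; apply/cvgrPdist_lt => e e0.
rewrite near_withinE; apply/nbhs_ballP.
exists (c * e) => /=; first exact: mulr_gt0.
move=> y; rewrite -ball_normE /= => + [z _ zy]; rewrite -zy => Txz.
rewrite inverse_on_rangeK// -(ltr_pM2l c0) (le_lt_trans (Tc _))//.
by rewrite linearB.
Qed.

Lemma opnorm_ge (R : realType) (V W : normedModType R) (T : {linear V -> W}) x :
  continuous T -> `|T x| <= opnorm T * `|x|.
Proof.
move=> /linear_bounded_continuous/linear_boundedP.
move=> /pinfty_ex_gt0[M M0 TM].
have [->|x0] := eqVneq x 0; first by rewrite linear0 !normr0 mulr0.
rewrite -ler_pdivrMr ?normr_gt0//; apply: ub_le_sup.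
  exists M => _ [y [_ /= y1] <-]; rewrite (le_trans (TM y))//.
  by rewrite ger_pMr.
exists (`|x|^-1 *: x).
  split=> //=; rewrite normrZ normfV normr_id mulVf//.
  by rewrite normr_eq0.
by rewrite linearZ/= normrZ normfV normr_id mulrC.
Qed.

(** Continuity of the inverse at 0 and homogeneity bound it on the range. So [inverse_norm T] is the
    supremum of a bounded set, and the vector [T x] scaled to norm 1 yields the inequality. *)
Lemma inverse_norm_ge (R : realType) (V W : normedModType R)
    (T : {linear V -> W}) x :
  into_isomorphism T -> `|x| <= inverse_norm T * `|T x|.
Proof.
move=> [_ Tinj /subspace_continuousP Tinv].
have [d d0 Td] : exists2 d, 0 < d & forall z, `|T z| < d -> `|z| < 1.
  have /(_ (T 0)) := Tinv; rewrite /from_subspace inverse_on_rangeK// linear0.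
  have R0 : range T 0 by exists 0 => //; rewrite linear0.
  move=> /(_ R0)/cvgrPdist_lt/(_ 1 ltr01); rewrite near_withinE.
  move=> /nbhs_norm0P[d /= d0 dT]; exists d => // z zd.
  have := dT _ zd; rewrite inverse_on_rangeK// sub0r normrN; apply.
  by exists z.
have Tb z : `|z| <= 2 / d * `|T z|.
  have [->|z0] := eqVneq z 0; first by rewrite linear0 !normr0 mulr0.
  have Tz0 : 0 < `|T z|.
    rewrite normr_gt0; apply: contra_neq z0 => Tz.
    by apply: Tinj; rewrite linear0.
  have k0 : 0 < d / 2 / `|T z| by rewrite !divr_gt0.
  have := Td ((d / 2 / `|T z|) *: z).
  rewrite linearZ/= (normrZ _ (T z)) (normrZ _ z).
  rewrite (gtr0_norm k0) divfK ?gt_eqF//.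
  have d2d : d / 2 < d by rewrite ltr_pdivrMr// ltr_pMr// ltr1n.
  move=> /(_ d2d)/ltW; rewrite -ler_pdivlMl//.
  by rewrite mulr1 invf_div invf_div mulrC.
have [->|x0] := eqVneq x 0; first by rewrite linear0 !normr0 mulr0.
have Tx0 : 0 < `|T x|.
  rewrite normr_gt0; apply: contra_neq x0 => Tx.
  by apply: Tinj; rewrite linear0.
rewrite -ler_pdivrMr//; apply: ub_le_sup.
  exists (2 / d) => _ [_ [[z _ <-] /= z1] <-].
  rewrite inverse_on_rangeK// (le_trans (Tb z))// ger_pMr//.
  by rewrite divr_gt0.
exists (T (`|T x|^-1 *: x)).
  split; first by exists (`|T x|^-1 *: x).
  by rewrite /= linearZ normrZ normfV normr_id mulVf// gt_eqF.
by rewrite inverse_on_rangeK// normrZ normfV normr_id mulrC.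
Qed.

Lemma opnorm_on_ge0 (R : realType) (V W : normedModType R) (D : set V)
    (g : V -> W) : 0 <= opnorm_on D g.
Proof.
rewrite /opnorm_on; set X := [set _ | _ in _].
(* A set without supremum has [sup] equal to 0 by convention. *)
have [X_sup|X_nosup] := pselect (has_sup X); last by rewrite sup_out.
case: (X_sup) => -[_ [x Dx _]] X_ub.
by apply: le_trans (normr_ge0 (g x)) _; apply: ub_le_sup => //; exists x.
Qed.

(** * Elements of spaces of continuous functions *)

Lemma supnorm_sumE (R : realType) (X : Type) (V : normedModType R)
    (F : bounded_submod X V) (I : Type) (r : seq I) (P : pred I)
    (f : I -> supnorm_space F) x :
  (\sum_(i <- r | P i) f i) x = \sum_(i <- r | P i) f i x.
Proof. exact: (big_morph (fun h : supnorm_space F => h x)). Qed.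

Lemma cspace_continuous (R : realType) (K : topologicalType)
    (cK : compact [set: K]) (E : normedModType R) (f : Cspace cK E) :
  continuous f.
Proof. by have /set_mem/= := sn_mem f. Qed.

Lemma continuous_mem (R : realType) (K : topologicalType)
    (cK : compact [set: K]) (E : normedModType R) (f : K -> E) :
  continuous f -> f \in bsm_pred (continuous_submod cK E).
Proof. by move=> fc; exact/mem_set. Qed.

Definition cspace_of (R : realType) (K : topologicalType)
    (cK : compact [set: K]) (E : normedModType R) (f : K -> E)
    (fc : continuous f) : Cspace cK E :=
  SupnormSpace f (continuous_mem cK fc).

(** * Sums of disjoint functions with coefficients in c_0 *)

Section disjoint_sequences.
Context (R : realType) (K : topologicalType) (cK : compact [set: K]).
Local Notation C := (Cspace cK R^o).

Definition pairwise_disjoint (g : nat -> C) :=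
  forall m n x, g m x != 0 -> g n x != 0 -> m = n.

(* At each point at most one summand of [sum_n a_n g_n] is nonzero; the infinite
   sum is encoded by selecting it. *)
Definition disjoint_sum_fun (g : nat -> C) (a : c0_space R) (x : K) : R^o :=
  let n := xget 0%N [set n | g n x != 0] in a n * g n x.

Lemma disjoint_sum_funE g n x : pairwise_disjoint g -> g n x != 0 ->
  forall a, disjoint_sum_fun g a x = a n * g n x.
Proof.
move=> gd gn0 a; rewrite /disjoint_sum_fun; case: xgetP => [m _ /= gm0|].
  by rewrite (gd _ _ _ gm0 gn0).
by move=> /(_ n)/=; rewrite gn0.
Qed.

(** The coefficients tend to 0 and at most one summand is nonzero at each point, so the sum is a
    uniform limit of its finite partial sums. *)
Lemma disjoint_sum_continuous g a : (forall n, `|g n| <= 1) ->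
  pairwise_disjoint g -> continuous (disjoint_sum_fun g a).
Proof.
move=> g1 gd x; apply/cvgrPdist_le => e e0.
have gx1 n y : `|g n y| <= 1.
  by rewrite (le_trans _ (g1 n))//; exact: supnorm_ub.
have e3 : 0 < e / 3 by rewrite divr_gt0.
have [N _ aN] : \forall n \near \oo, `|a n| <= e / 3.
  have /set_mem/= a0 := sn_mem a.
  by have /cvgr0Pnorm_le := a0; apply.
pose P : C := \sum_(n < N) a n *: g n.
have PE y : P y = \sum_(n < N) a n * g n y by rewrite /P supnorm_sumE.
have Pe y : `|disjoint_sum_fun g a y - P y| <= e / 3.
  have [[n gn0]|/forallNP gn0] := pselect (exists n, g n y != 0).
    rewrite (disjoint_sum_funE gd gn0) PE.
    have gm m : m != n -> g m y = 0.
      move=> mn; apply/eqP; apply: contraNT mn => gm0.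
      by apply/eqP; exact: gd gm0 gn0.
    have [nN|Nn] := ltnP n N.
      rewrite (bigD1 (Ordinal nN))//= big1 => [|i iN].
        by rewrite addr0 subrr normr0 ltW.
            by apply/eqP; rewrite mulf_eq0 gm ?eqxx ?orbT.
    rewrite big1 ?subr0.
      by rewrite normrM (le_trans _ (aN n Nn))// ler_piMr.
    by move=> i _; rewrite gm ?mulr0// ltn_eqF// (leq_trans _ Nn).
  have g0 n : g n y = 0 by apply/eqP/negPn/negP; exact: gn0.
  rewrite /disjoint_sum_fun g0 mulr0 PE big1 ?subr0 ?normr0 ?ltW// => i _.
  by rewrite g0 mulr0.
have /cvgrPdist_le/(_ _ e3) := @cspace_continuous _ _ _ _ P x.
apply: filterS => y Pxy.
have -> : disjoint_sum_fun g a x - disjoint_sum_fun g a y =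
  (disjoint_sum_fun g a x - P x) + (P x - P y) -
  (disjoint_sum_fun g a y - P y) by ring.
rewrite (le_trans (ler_normB _ _))//
  (le_trans (lerD (ler_normD _ _) (lexx _)))//.
have := Pe x; have := Pe y; lra.
Qed.

Definition disjoint_sum g (g1 : forall n, `|g n| <= 1)
  (gd : pairwise_disjoint g)
  (a : c0_space R) : C := cspace_of cK (@disjoint_sum_continuous g a g1 gd).

Lemma disjoint_sum_linear g (g1 : forall n, `|g n| <= 1)
  (gd : pairwise_disjoint g) : linear (disjoint_sum g1 gd).
Proof.
move=> k a b; apply/val_inj/funext => x.
by rewrite /= /disjoint_sum_fun /=; rewrite [LHS]mulrDl -mulrA.
Qed.

Lemma disjoint_sum_le g (g1 : forall n, `|g n| <= 1)
  (gd : pairwise_disjoint g) a : `|disjoint_sum g1 gd a| <= `|a|.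
Proof.
apply: supnorm_le => [|x]; first exact: normr_ge0.
rewrite /= /disjoint_sum_fun normrM -[leRHS]mulr1 ler_pM//.
  exact: supnorm_ub.
by apply: le_trans (g1 (xget 0%N [set n | g n x != 0])); exact: supnorm_ub.
Qed.

End disjoint_sequences.

(** All but finitely many terms are smaller than a fixed nonzero one, so the maximum is taken over a
    finite set. *)
Lemma c0_norm_attained (R : realType) (a : c0_space R) : a != 0 ->
  exists2 i, a i != 0 & forall j, `|a j| <= `|a i|.
Proof.
move=> a0; have [m am0] : exists m, a m != 0.
  apply: contraPP a0 => /forallNP am0; apply/negP/negPn/eqP/val_inj/funext => m.
  by apply/eqP/negPn/negP; exact: am0.
have /set_mem/= a_cvg0 := sn_mem a.
have am_gt0 : 0 < `|a m| by rewrite normr_gt0.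
have [N _ aN] : \forall n \near \oo, `|a n| < `|a m|.
  by have /cvgr0Pnorm_lt := a_cvg0; apply.
have mN : (m < N)%N by rewrite ltnNge; apply/negP => /aN/=; rewrite ltxx.
have [i _ ai] := @arg_maxP _ R 'I_N (Ordinal mN) xpredT (fun i => `|a i|) isT.
have ami : `|a m| <= `|a i| := ai (Ordinal mN) isT.
exists i; first by rewrite -normr_gt0 (lt_le_trans am_gt0).
move=> j; have [jN|Nj] := ltnP j N; first exact: (ai (Ordinal jN)).
by rewrite (le_trans _ ami)// ltW// aN.
Qed.

(** * Disjoint functions under an operator into a space without c_0 *)

Section no_c0.
Context (R : realType) (K : topologicalType) (cK : compact [set: K])
  (E : normedModType R) (E_c0 : ~ embeds_isomorphically (c0_space R) E)
  (L : {linear Cspace cK R^o -> E}) (M : R) (M0 : 0 <= M)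
  (LM : forall f, `|L f| <= M * `|f|).
Local Notation C := (Cspace cK R^o).

(** If the images had norm at least [d * |a|] for every [a], c_0 would embed into [E]. So some [a]
    violates this bound, and dividing it by its coordinate of largest modulus gives [b]. *)
Lemma disjoint_sum_small (g : nat -> C) (g1 : forall n, `|g n| <= 1)
    (gd : pairwise_disjoint g) (d : R) : 0 < d ->
  exists (b : c0_space R) i,
    [/\ b i = 1, forall j, `|b j| <= 1 & `|L (disjoint_sum g1 gd b)| < d].
Proof.
move=> d0; pose V := fun a => L (disjoint_sum g1 gd a).
have V_lin : linear V.
  by move=> k a b; rewrite /V disjoint_sum_linear linearP.
pose Vl := HB.pack_for {linear c0_space R -> E} V
  (GRing.isLinear.Build R (c0_space R) E *:%R V V_lin).
have [a ad] : exists a, `|V a| < d * `|a|.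
  apply: contrapT => /forallNP nV; apply: E_c0; exists Vl.
  apply: (@bounded_below_into_isomorphism _ _ _ Vl M d) => // a.
    by rewrite (le_trans (LM _))// ler_wpM2l ?disjoint_sum_le.
  by rewrite leNgt; apply/negP/nV.
have a0 : a != 0.
  apply: contraTneq ad => ->; rewrite normr0 mulr0 -leNgt.
  exact: normr_ge0.
have [i ai0 ai] := c0_norm_attained a0.
have ai_gt0 : 0 < `|a i| by rewrite normr_gt0.
exists ((a i)^-1 *: a), i; split.
- exact: (mulVf ai0).
- move=> j; rewrite [X in `|X|](_ : _ = (a i)^-1 * a j)//.
  by rewrite normrM normfV mulrC ler_pdivrMr// mul1r.
rewrite [X in `|X|](linearZ_LR Vl) normrZ normfV mulrC ltr_pdivrMr//.
rewrite (lt_le_trans ad)// ler_pM2l//.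
by apply: supnorm_le.
Qed.

(* As E does not contain c_0, on each infinite subfamily (gp p n)_n the map
   b |-> L (sum_n b_n gp p n) is not bounded below, so |L b| < r / 2 for some b
   of norm 1 with b_i = 1. Flipping the signs of its other coefficients gives
   2 e_i - b, still of norm 1, whose image has norm at least 2 r - r / 2. *)
Lemma disjoint_sequence_amplify (g : nat -> C) (r : R) : 0 < r ->
  (forall n, `|g n| <= 1) -> pairwise_disjoint g ->
  (forall n, r <= `|L (g n)|) ->
  exists h : nat -> C, [/\ forall n, `|h n| <= 1, pairwise_disjoint h &
    forall n, 3 / 2 * r <= `|L (h n)|].
Proof.
move=> r0 g1 gd gr.
pose phi (p n : nat) := pickle (p, n).
have phi_inj p m q n : phi p m = phi q n -> p = q /\ m = n.
  by move=> /(pcan_inj pickleK)[].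
pose gp p n := g (phi p n).
have gp1 p n : `|gp p n| <= 1 by exact: g1.
have gpd p : pairwise_disjoint (gp p).
  by move=> m n x gm gn; have /phi_inj[] := gd _ _ _ gm gn.
have r2 : 0 < r / 2 by rewrite divr_gt0.
have /choice[b /choice[i bi]] := fun p => disjoint_sum_small (gp1 p) (gpd p) r2.
pose U p := disjoint_sum (gp1 p) (gpd p) (b p).
pose z p : C := 2 *: gp p (i p) - U p.
have zE p x : z p x = 2 * gp p (i p) x - U p x by [].
have z0 p x : z p x != 0 -> exists n, gp p n x != 0.
  apply: contra_neqP => /forallNP gp0.
  have {}gp0 n : gp p n x = 0 by apply/eqP/negPn/negP; exact: gp0.
  by rewrite zE /= /disjoint_sum_fun !gp0 !mulr0 subrr.
exists z; split.
- move=> p; apply: supnorm_le => // x; have [bi1 b1 _] := bi p.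
  have [->|/z0[n gn0]] := eqVneq (z p x) 0; first by rewrite normr0.
  have gx1 : `|gp p n x| <= 1 by exact: le_trans (supnorm_ub _ _) (gp1 p n).
  rewrite zE /= (disjoint_sum_funE (gpd p) gn0).
  have [ni|ni] := eqVneq n (i p).
    by rewrite -ni in bi1 *; rewrite bi1 -mulrBl addrK mul1r.
  have -> : gp p (i p) x = 0.
    apply/eqP; apply: contraNT ni => gi0.
    by apply/eqP; exact: gpd gn0 gi0.
  by rewrite mulr0 sub0r normrN normrM mulr_ile1.
- by move=> p q x /z0[m gm] /z0[n gn]; have /phi_inj[] := gd _ _ _ gm gn.
move=> p; have [_ _ Ub] := bi p.
rewrite /z linearB linearZ/=; apply: le_trans (lerB_dist _ _).
rewrite normrZ ger0_norm//; have := gr (phi p (i p)); rewrite -/(gp p (i p)).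
by move: Ub; rewrite -/(U p); lra.
Qed.

(** Each amplification multiplies the lower bound by 3/2, so finitely many of them exceed the bound
    [M] valid on functions of norm at most 1. *)
Lemma no_large_disjoint_sequence (g : nat -> C) (r : R) : 0 < r ->
  (forall n, `|g n| <= 1) -> pairwise_disjoint g ->
  exists n, `|L (g n)| < r.
Proof.
move=> r0 g1 gd; apply: contrapT => /forallNP gr.
have [m Mm] : exists m : nat, M < (3 / 2) ^+ m * r.
  have bernoulli m : 1 + m%:R / 2 <= (3 / 2 : R) ^+ m.
    elim: m => [|m IHm]; first by rewrite mul0r addr0 expr0.
    rewrite exprS; have : 0 <= m%:R :> R by [].
    by rewrite -[in X in _ -> X <= _]natr1; nra.
  exists (Num.bound (2 * (M / r))); rewrite -ltr_pdivrMr//.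
  apply: lt_le_trans (bernoulli _).
  have : 2 * (M / r) < (Num.bound (2 * (M / r)))%:R.
    by apply: archi_boundP; rewrite mulr_ge0// divr_ge0// ltW.
  lra.
have [h [h1 _ hr]] : exists h : nat -> C, [/\ forall n, `|h n| <= 1,
    pairwise_disjoint h & forall n, (3 / 2) ^+ m * r <= `|L (h n)|].
  elim: m {Mm} => [|m [h [h1 hd hr]]].
    by exists g; split => // n; rewrite expr0 mul1r leNgt; apply/negP/gr.
  have hr0 : 0 < (3 / 2) ^+ m * r by rewrite mulr_gt0// exprn_gt0// divr_gt0.
  have [k [k1 kd kr]] := disjoint_sequence_amplify hr0 h1 hd hr.
  by exists k; split => // n; rewrite exprS -mulrA.
have := le_trans (hr 0%N) (LM (h 0%N)); apply/negP; rewrite -ltNge.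
by rewrite (le_lt_trans _ Mm)// ler_piMr ?h1.
Qed.
End no_c0.

(** * Derived sets and bump functions in compact spaces *)

Lemma cantor_bendixson_closed (S : topologicalType) n :
  hausdorff_space S -> closed (cantor_bendixson S n).
Proof.
move=> hS; elim: n => [|n IHn]; first exact: closedT.
by apply: closedI => //; exact/limit_point_closed/hausdorff_accessible.
Qed.

Lemma sub_cantor_bendixson (S : topologicalType) m n : (m <= n)%N ->
  cantor_bendixson S n `<=` cantor_bendixson S m.
Proof.
move=> /subnK<-; elim: (n - m)%N => // k IHk.
by rewrite addSn => x [+ _]; exact: IHk.
Qed.

(** The sets containing all but finitely many points of [A] form a proper filter; its cluster points
    are limit points, as [A] minus one point still belongs to it. *)
Lemma compact_infinite_limit_point (S : topologicalType) (A : set S) :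
  compact [set: S] -> infinite_set A -> limit_point A !=set0.
Proof.
move=> cS Ainf; pose F : set_system S := [set B | finite_set (A `\` B)].
have FF : ProperFilter F.
  split; first by rewrite /F /= setD0.
  split=> [|B B' FB FB'|B B' BB'].
  - by rewrite /F /= setDT.
  - by rewrite /F /= setDIr finite_setU.
  - by apply: sub_finite_set => y [Ay B'y]; split=> // /BB'.
have [|x [_ xF]] := cS F FF; first by rewrite /F /= setDT.
exists x => U xU; have [|y [[Ay yx] Uy]] := xF (A `\ x) U _ xU.
  rewrite /F /= setDD; apply: sub_finite_set (finite_set1 x).
  exact: subIsetr.
by exists y; split=> //; exact/eqP.
Qed.

(** Urysohn's lemma is applied to the closure of a smaller neighbourhood [V], so that the value 1 is
    taken near [x] and not only at [x]. *)
Lemma cspace_bump (R : realType) (K : topologicalType) (cK : compact [set: K])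
    (x : K) (U : set K) : hausdorff_space K -> nbhs x U ->
  exists f : Cspace cK R^o, [/\ forall y, 0 <= f y <= 1,
    forall y, ~ U y -> f y = 0 & \forall y \near x, f y = 1].
Proof.
move=> hK xU.
have [V xV VU] : exists2 V, nbhs x V & closure V `<=` U^°.
  have reg := @compact_regular K x setT hK cK (@filterT _ (nbhs x) _).
  by have [V xV VU] := reg _ _ (nbhs_interior xU); exists V.
have sep : uniform_separator (~` U^°) (closure V).
  apply: (@normal_separatorP R K).1.
  - exact: compact_normal.
  - exact/open_closedC/open_interior.
  - exact: closed_closure.
  - by rewrite setIC; apply/disjoints_subset; rewrite setCK.
have [f [fc f01 f0 f1]] := (@uniform_separatorP K R _ _).1 sep.
exists (cspace_of cK (fc : continuous (f : K -> R^o))); split => [y|y Uy|].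
- by have /= := f01 (f y); rewrite in_itv; apply; exists y.
- by apply: f0; exists y => // /interior_subset.
- apply: filterS xV => y Vy; apply: f1; exists y => //.
  exact: subset_closure.
Qed.

(** * Small images of bumps close to a point *)

Section vanishing.
Context (R : realType) (K : topologicalType) (cK : compact [set: K])
  (E : normedModType R) (E_c0 : ~ embeds_isomorphically (c0_space R) E).

(** Otherwise a counterexample exists in every neighbourhood of [x]. As it vanishes near [x], the
    next one can be taken inside its zero set, which produces a disjoint sequence with large
    images. *)
Lemma near_small_bump (L : {linear Cspace cK R^o -> E}) (M : R) : 0 <= M ->
  (forall f, `|L f| <= M * `|f|) -> forall (x : K) (r : R), 0 < r ->
  exists2 W, nbhs x W & forall g : Cspace cK R^o, `|g| <= 1 ->
    (forall y, ~ W y -> g y = 0) -> (\forall y \near x, g y = 0) -> `|L g| < r.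
Proof.
move=> M0 LM x r r0; apply: contrapT => nW.
(* [G] is defined on all sets; where [W] is not a neighbourhood of [x] its value is arbitrary. *)
have /choice[G G_] : forall W, exists g : Cspace cK R^o, nbhs x W ->
    [/\ `|g| <= 1, forall y, ~ W y -> g y = 0, (\forall y \near x, g y = 0) &
        r <= `|L g|].
  move=> W; apply: contrapT => /forallNP nG; apply: nW.
  have xW : nbhs x W by apply: contrapT => nxW; apply: (nG 0).
  exists W => // g g1 gW gx; rewrite ltNge; apply/negP => rg.
  by apply: (nG g).
pose W := fix W n :=
  if n is m.+1 then W m `&` [set y | G (W m) y = 0] else setT.
have xW n : nbhs x (W n).
  elim: n => [|n IHn]; first exact: filterT.
  by apply: filterI => //; have [] := G_ _ IHn.
have W_le m n : (m <= n)%N -> W n `<=` W m.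
  move=> /subnK<-; elim: (n - m)%N => // k IHk.
  by rewrite addSn => y [+ _]; exact: IHk.
pose g n := G (W n).
have gW n y : g n y != 0 -> W n y.
  apply: contra_neqP; have [_ + _ _] := G_ _ (xW n); exact.
have g_lt m n y : (m < n)%N -> g n y != 0 -> g m y = 0.
  by move=> /W_le mn /gW/mn[_].
have gd : pairwise_disjoint g.
  move=> m n y gm gn; have [mn|nm|//] := ltngtP m n.
    by rewrite (g_lt _ _ _ mn gn) eqxx in gm.
  by rewrite (g_lt _ _ _ nm gm) eqxx in gn.
have g1 n : `|g n| <= 1 by have [] := G_ _ (xW n).
have [n] := no_large_disjoint_sequence E_c0 M0 LM r0 g1 gd.
by rewrite ltNge; have [_ _ _ ->] := G_ _ (xW n).
Qed.

End vanishing.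

(** * Chains of nested bumps *)

Section chains.
Context (R : realType) (K1 K2 : topologicalType)
  (hK1 : hausdorff_space K1) (hK2 : hausdorff_space K2)
  (cK1 : compact [set: K1]) (cK2 : compact [set: K2]) (E : normedModType R)
  (E_c0 : ~ embeds_isomorphically (c0_space R) E)
  (S : {linear Cspace cK1 R^o -> Cspace cK2 E}) (A : R) (A0 : 0 <= A)
  (SA : forall f, `|S f| <= A * `|f|) (eps : R) (eps0 : 0 < eps).
Local Notation C1 := (Cspace cK1 R^o).

Lemma near_small_bump_finite (x : K1) (F : set K2) : finite_set F ->
  exists2 W, nbhs x W & forall g : C1, `|g| <= 1 ->
    (forall y, ~ W y -> g y = 0) -> (\forall y \near x, g y = 0) ->
    forall z, F z -> `|S g z| < eps.
Proof.
move=> /finite_setP[n]; elim: n F => [|n IHn] F.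
  by rewrite II0 card_eq0 => /eqP->; exists setT => //; exact: filterT.
move=> /eq_cardSP[z Fz /IHn[W xW WF]].
pose L f := S f z.
have L_lin : linear L by move=> c f g; rewrite /L linearP.
pose Ll := HB.pack_for {linear C1 -> E} L
  (GRing.isLinear.Build R C1 E *:%R L L_lin).
have LA f : `|Ll f| <= A * `|f|.
  by rewrite (le_trans _ (SA f))//; exact: supnorm_ub.
have [V xV VL] := near_small_bump E_c0 A0 LA x eps0.
exists (W `&` V); first exact: filterI.
move=> g g1 gWV gx y Fy; have [->|yz] := pselect (y = z).
  by apply: VL => // u Vu; apply: gWV => -[].
by apply: WF => // u Wu; apply: gWV => -[].
Qed.

Definition nactive (f : nat -> C1) n y :=
  (\sum_(i < n) (eps <= `|S (f i) y|)%R)%N.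

(** A function inactive at [y] stays inactive near [y], since the condition [< eps] is open. *)
Lemma near_nactive_le f n y :
  \forall z \near y, (nactive f n z <= nactive f n y)%N.
Proof.
elim: n => [|n IHn]; first by apply: nearW => z; rewrite /nactive big_ord0.
have [fy|fy] := leP eps `|S (f n) y|.
  apply: filterS IHn => z zy; rewrite /nactive !big_ord_recr/= fy leq_add//.
  exact: leq_b1.
have : \forall z \near y, `|S (f n) z| < eps.
  by apply: cvgr_norm_lt fy; exact: cspace_continuous.
apply: filterS2 IHn => z zy fz; rewrite /nactive !big_ord_recr/=.
by rewrite (lt_geF fz) addn0 (leq_trans zy)// leq_addr.
Qed.

(** The induction invariant. Level 0 says that fewer than [k] functions are active anywhere; the
    higher levels keep finite the set of critical points, where one more active function would break
    the bound. *)
Definition nactive_bounded k f n := forall q y,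
  cantor_bendixson K2 q y -> (nactive f n y + q < k)%N.

(** Infinitely many critical points of one level [q] would accumulate at a point of level [q.+1]
    with at least as many active functions, against the invariant. *)
Lemma finite_critical k f n : nactive_bounded k f n ->
  finite_set [set y | exists2 q, cantor_bendixson K2 q y &
                        (nactive f n y + q).+1 = k].
Proof.
move=> fk.
pose F q := [set y | cantor_bendixson K2 q y /\ (nactive f n y + q).+1 = k].
suff Ffin q : finite_set (F q).
  apply: (@sub_finite_set _ _ (\bigcup_(q in `I_k) F q)).
    move=> y [q yq yk]; exists q => //=.
    by rewrite -yk ltnS leq_addl.
  exact: bigcup_finite.
apply: contrapT => /(compact_infinite_limit_point cK2)[z zF].
have zq : cantor_bendixson K2 q.+1 z.
  have zq' : limit_point (cantor_bendixson K2 q) z.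
    by move=> U /zF[y [yz [yq _] Uy]]; exists y.
  split=> //; apply: (cantor_bendixson_closed hK2).
  exact: subset_limit_point.
have [y [_ [yq yk] /= yz]] := zF _ (near_nactive_le f n z).
have := fk _ _ zq; rewrite -yk addnS ltnNge ltnS.
by rewrite leq_add2r yz.
Qed.

(** Induction on [n] with a moving base point: each bump costs one derivative of [K1], and [j]
    counts those left. That all bumps are 1 near [x] leaves room to nest the next one. *)
Lemma exists_chain k n j x0 : cantor_bendixson K2 k = set0 ->
  cantor_bendixson K1 (n + j) x0 ->
  exists (f : nat -> C1) x, [/\ cantor_bendixson K1 j x,
    forall i y, (i < n)%N -> 0 <= f i y <= 1,
    forall i i' y, (i < i' < n)%N -> f i' y != 0 -> f i y = 1,
    \forall y \near x, forall i, (i < n)%N -> f i y = 1 &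
    nactive_bounded k f n].
Proof.
move=> K2k; elim: n j => [|n IHn] j; first rewrite add0n => x0j.
  exists (fun=> 0), x0; split=> //; first by move=> i i' y /andP[].
    exact: nearW.
  (* Without bumps the invariant says that the derived sets of order at least [k] are empty. *)
  move=> q y yq; rewrite /nactive big_ord0 add0n ltnNge; apply/negP => kq.
  by have := sub_cantor_bendixson kq yq; rewrite K2k.
rewrite addSnnS => /IHn[f [x [[_ xj] f01 f_nest f1 fk]]].
have [W xW WS] := near_small_bump_finite x (finite_critical fk).
pose U := W `&` [set y | forall i, (i < n)%N -> f i y = 1].
have xU : nbhs x U by exact: filterI.
(* The new bump is centred at a point other than [x], so that it can vanish near [x]; then the
   choice of [W] makes its image small at the critical points. *)
have [x' [x'x x'j x'U]] := xj _ (nbhs_interior xU).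
have [P [Q [x'P xQ PQ]]] :
    exists P Q, [/\ nbhs x' P, nbhs x Q & P `&` Q = set0].
  move: hK1; rewrite open_hausdorff => /(_ x' x x'x)[[P Q] /= [x'P xQ]].
  move=> [oP oQ PQ]; exists P, Q; split=> //.
  - by apply: open_nbhs_nbhs; split=> //; exact/set_mem.
  - by apply: open_nbhs_nbhs; split=> //; exact/set_mem.
  - exact/eqP.
have x'UP : nbhs x' (U^° `&` P).
  by apply: filterI => //; exact: nbhs_interior.
have [g [g01 g0 g1]] := cspace_bump R cK1 hK1 x'UP.
have gU y : g y != 0 -> U y.
  by apply: contra_neqP => Uy; apply: g0 => -[/interior_subset].
have g_small y q : cantor_bendixson K2 q y -> (nactive f n y + q).+1 = k ->
    `|S g y| < eps.
  move=> yq yk; apply: WS; last by exists q.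
  - apply: supnorm_le => // z; have /andP[gz0 gz1] := g01 z.
    by rewrite ger0_norm.
  - by move=> z Wz; apply: g0 => -[/interior_subset[]].
  - apply: filterS xQ => z Qz; apply: g0 => -[_ Pz].
    by have : (P `&` Q) z by []; rewrite PQ.
pose h i := if i == n then g else f i.
have hn : h n = g by rewrite /h eqxx.
have hf i : (i < n)%N -> h i = f i by move=> i_n; rewrite /h ltn_eqF.
exists h, x'; split=> //.
- move=> i y; rewrite ltnS leq_eqVlt => /predU1P[->|i_n]; first by rewrite hn.
  by rewrite hf// f01.
- move=> i i' y /andP[ii']; rewrite ltnS leq_eqVlt => /predU1P[i'n|i'n].
    by rewrite i'n in ii' *; rewrite hn hf// => /gU[_]; exact.
  by rewrite !hf ?(ltn_trans ii')//; apply: f_nest; rewrite ii'.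
- apply: filterS2 x'UP g1 => y [/interior_subset[_ fy] _] gy i.
  rewrite ltnS leq_eqVlt => /predU1P[->|i_n]; first by rewrite hn.
  by rewrite hf// fy.
- move=> q y yq; rewrite /nactive big_ord_recr/= hn.
  rewrite (eq_bigr (fun i : 'I_n => (eps <= `|S (f i) y|)%R : nat)); last first.
    by move=> i _; rewrite hf.
  (* At a critical point [g] is inactive; elsewhere the bound leaves room for one more active
     function. *)
  have := fk _ _ yq; rewrite -/(nactive f n y) leq_eqVlt => /predU1P[yk|].
    by rewrite (lt_geF (g_small _ _ yq yk)) addn0 -yk.
  move=> yk; rewrite addnAC (leq_ltn_trans _ yk)// -addn1 leq_add2l.
  exact: leq_b1.
Qed.


Lemma leq_nactive f m n y : (m <= n)%N -> (nactive f m y <= nactive f n y)%N.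
Proof.
move=> /subnK<-; elim: (n - m)%N => // p IHp.
by rewrite addSn (leq_trans IHp)// /nactive big_ord_recr leq_addr.
Qed.

Lemma exists_inactive f m n y : (m <= n)%N -> (nactive f n y < m)%N ->
  exists2 i, (i < m)%N & `|S (f i) y| < eps.
Proof.
move=> mn; apply: contraPP => act; apply/negP; rewrite -leqNgt.
apply: leq_trans (leq_nactive f y mn).
rewrite /nactive (eq_bigr (fun=> 1%N)) ?sum1_card ?card_ord// => i _.
case: leP => // lt_eps; exfalso; apply: act.
by exists i.
Qed.

(** * The two distortion estimates for scalar functions *)

Context (B : R) (B0 : 0 <= B) (SB : forall f, `|f| <= B * `|S f|).

Let S_le (f : C1) y : `|f| <= 1 -> `|S f y| <= A.
Proof.
move=> f1; rewrite (le_trans (supnorm_ub _ _))// (le_trans (SA _))//.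
by rewrite ler_piMr.
Qed.

Lemma three_le_distortion k x0 : (1 < k)%N -> cantor_bendixson K2 k = set0 ->
  cantor_bendixson K1 k x0 -> 3 <= B * (A + 2 * eps).
Proof.
move=> k1 K2k; rewrite -[k in cantor_bendixson K1 k]addn0 => K1k.
have [f [x [_ f01 f_nest /nbhs_singleton f1 fk]]] := exists_chain K2k K1k.
have k0 : (0 < k)%N by exact: ltnW.
have k1k : (k.-1 < k)%N by rewrite prednK.
pose h : C1 := f 0%N + 2 *: f k.-1.
have hx : 3 <= `|h|.
  apply: le_trans (supnorm_ub h x).
  rewrite [h x](_ : _ = f 0%N x + 2 * f k.-1 x)// !f1//.
  by rewrite ger0_norm; lra.
apply: (le_trans hx); apply: (le_trans (SB _)); rewrite ler_wpM2l//.
apply: supnorm_le => [|y].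
  by rewrite addr_ge0// mulr_ge0// ltW.
have [i ik fi] : exists2 i, (i < k)%N & `|S (f i) y| < eps.
  by apply: (exists_inactive (leqnn k)); have := fk 0%N y I; rewrite addn0.
have f0b z := f01 0%N z k0; have fkb z := f01 _ z k1k; have fib z := f01 _ z ik.
have fk0 z : f k.-1 z != 0 -> f 0%N z = 1.
  by apply: f_nest; rewrite k1k andbT -ltnS prednK.
(* Since [f i] is inactive at [y], changing [h] by [c *: f i] costs at most [2 * eps] there. *)
suff [g [g1 gh]] : exists g : C1, `|g| <= 1 /\ exists2 c : R, `|c| <= 2 &
    h = g + c *: f i.
  have [c c2 ->] := gh; rewrite linearD linearZ/=.
  rewrite [_ y](_ : _ = S g y + c *: S (f i) y)//.
  rewrite (le_trans (ler_normD _ _))// lerD ?S_le// normrZ.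
  by rewrite ler_pM// ltW.
(* In the two extreme cases [g] is [h - 2 *: f i]: it equals [2 *: f k.-1 - f 0] for [i = 0], of
   norm at most 1 because [f 0] is 1 where [f k.-1] is nonzero, and [f 0] for [i = k.-1]. *)
have [i0|i0] := eqVneq i 0%N.
  exists (2 *: f k.-1 - f 0%N); split; last first.
    exists 2; first by rewrite ger0_norm.
    rewrite i0 (scaler_nat 2 (f 0%N)) mulr2n.
    by rewrite addrA subrK addrC.
  apply: supnorm_le => // z.
  rewrite [X in `|X|](_ : _ = 2 * f k.-1 z - f 0%N z)//.
  have /andP[? ?] := f0b z; have /andP[? ?] := fkb z.
  rewrite ler_norml; have [->|/fk0->] := eqVneq (f k.-1 z) 0; lra.
have [ik1|ik1] := eqVneq i k.-1.
  exists (f 0%N); split; last by exists 2; rewrite ?ger0_norm// ik1.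
  apply: supnorm_le => // z; have /andP[? ?] := f0b z.
  by rewrite ger0_norm.
have fi0 z : f i z != 0 -> f 0%N z = 1.
  by apply: f_nest; rewrite ik lt0n i0.
have fki z : f k.-1 z != 0 -> f i z = 1.
  by apply: f_nest; rewrite k1k andbT ltn_neqAle ik1 -ltnS prednK.
(* By nesting, the values are [2 * f k.-1 z - 1] where [f k.-1] is nonzero, [1 - 2 * f i z] where
   only [f i] and [f 0] are, and [f 0 z] elsewhere. *)
exists (f 0%N - 2 *: f i + 2 *: f k.-1); split; last first.
  exists 2; first by rewrite ger0_norm.
  by rewrite addrAC subrK.
apply: supnorm_le => // z.
rewrite [X in `|X|](_ : _ = f 0%N z - 2 * f i z + 2 * f k.-1 z)//.
have /andP[? ?] := f0b z; have /andP[? ?] := fkb z; have /andP[? ?] := fib z.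
rewrite ler_norml; have [->|kz] := eqVneq (f k.-1 z) 0.
  by have [->|/fi0->] := eqVneq (f i z) 0; lra.
by rewrite (fki _ kz) (fk0 _ kz); lra.
Qed.

(** The index is shifted: [k.+1] bounds the height of [K2], so at most [k] functions are active at
    each point. *)
Lemma linear_le_distortion k n x0 : (k <= n)%N ->
  cantor_bendixson K2 k.+1 = set0 -> cantor_bendixson K1 n x0 ->
  (k + 2 * (n - k))%:R <= B * (k%:R * A + (k%:R + 2 * n%:R) * eps).
Proof.
move=> kn K2k; rewrite -[n in cantor_bendixson K1 n]addn0 => K1n.
have [f [x [_ f01 f_nest /nbhs_singleton f1 fk]]] := exists_chain K2k K1n.
pose c i : R := if (i < k)%N then 1 else 2.
have c0 i : 0 <= c i by rewrite /c; case: ifP.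
have c2 i : c i <= 2 by rewrite /c; case: ifP => // _; rewrite ler1n.
have sum_c : \sum_(i < n) c i = (k + 2 * (n - k))%:R.
  rewrite -(big_mkord xpredT) (big_cat_nat (leq0n k) kn)//= natrD.
  congr (_ + _).
    rewrite (@eq_big_nat _ _ _ _ _ _ (fun=> 1)) => [|i /andP[_ ik]].
      by rewrite sumr_const_nat subn0.
    by rewrite /c ik.
  rewrite (@eq_big_nat _ _ _ _ _ _ (fun=> 2)) => [|i /andP[ki _]].
    by rewrite sumr_const_nat natrM mulr_natr.
  by rewrite /c ltnNge ki.
pose h : C1 := \sum_(i < n) c i *: f i.
have hx : (k + 2 * (n - k))%:R <= `|h|.
  apply: le_trans (supnorm_ub h x); rewrite -sum_c.
  apply: le_trans (ler_norm _); rewrite /h supnorm_sumE ler_sum// => i _.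
  by rewrite [X in _ <= X](_ : _ = c i * f i x)// f1// mulr1.
apply: (le_trans hx); apply: (le_trans (SB _)); rewrite ler_wpM2l//.
apply: supnorm_le => [|y].
  by rewrite addr_ge0// mulr_ge0// ?addr_ge0// ltW.
have yk : (nactive f n y <= k)%N by have := fk 0%N y I; rewrite addn0 ltnS.
(* An active term costs at most [A + eps] and an inactive one at most [2 * eps], as [c i <= 2]. *)
have act i : (i < n)%N ->
    c i * `|S (f i) y| <= (eps <= `|S (f i) y|)%R%:R * (A + eps) + 2 * eps.
  move=> i_n; have fi1 : `|f i| <= 1.
    apply: supnorm_le => // z; have /andP[? ?] := f01 _ z i_n.
    by rewrite ger0_norm.
  case: (leP eps) => [fi|/ltW fi]; last first.
    by rewrite mul0r add0r ler_pM.
  rewrite mul1r; have [ik|ki] := ltnP i k.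
    by rewrite /c ik mul1r; have := S_le y fi1; move: eps0; lra.
  (* As [k <= i], the [i.+1] functions up to [f i] outnumber the active ones; the inactive one found
     is not [f i] itself. *)
  have [j ji fj] : exists2 j, (j < i.+1)%N & `|S (f j) y| < eps.
    by apply: (exists_inactive i_n); exact: leq_ltn_trans yk _.
  have {}ji : (j < i)%N.
    rewrite ltn_neqAle -ltnS ji andbT; apply: contraTneq fj => ->.
    by rewrite -leNgt.
  have : `|S (f j - 2 *: f i) y| <= A.
    apply: S_le; apply: supnorm_le => // z.
    rewrite [X in `|X|](_ : _ = f j z - 2 * f i z)//.
    have /andP[? ?] := f01 _ z i_n.
    have /andP[? ?] := f01 _ z (ltn_trans ji i_n).
    rewrite ler_norml; have [->|iz] := eqVneq (f i z) 0; first lra.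
    by rewrite (f_nest j i)// ?ji//; lra.
  rewrite linearB linearZ/= [_ y](_ : _ = S (f j) y - 2 *: S (f i) y)// => fjiA.
  have := le_trans (lerB_dist _ _) (_ : `|2 *: S (f i) y - S (f j) y| <= A).
  rewrite distrC => /(_ fjiA); rewrite normrZ ger0_norm// /c ltnNge ki/=.
  by move: fj eps0; lra.
rewrite /h linear_sum supnorm_sumE (le_trans (ler_norm_sum _ _ _))//.
have /le_trans : \sum_(i < n) `|S (c i *: f i) y| <=
    \sum_(i < n) ((eps <= `|S (f i) y|)%R%:R * (A + eps) + 2 * eps).
  apply: ler_sum => i _; rewrite linearZ/= [_ y](_ : _ = c i *: S (f i) y)//.
  by rewrite normrZ ger0_norm// act.
apply; rewrite big_split/= -mulr_suml -natr_sum sumr_const card_ord.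
rewrite -/(nactive f n y).
have : (nactive f n y)%:R * (A + eps) <= k%:R * (A + eps).
  by rewrite ler_wpM2r ?ler_nat// addr_ge0// ltW.
by rewrite -[_ *+ n]mulr_natr; lra.
Qed.

End chains.

(** * Reduction to scalar functions and passage to the limit *)

Lemma scalar_restriction (R : realType) (K1 K2 : topologicalType)
    (cK1 : compact [set: K1]) (cK2 : compact [set: K2])
    (E1 E2 : normedModType R) (T : {linear Cspace cK1 E1 -> Cspace cK2 E2})
    (A B : R) : (exists x : E1, x != 0) ->
  (forall f, `|T f| <= A * `|f|) -> (forall f, `|f| <= B * `|T f|) ->
  exists S : {linear Cspace cK1 R^o -> Cspace cK2 E2},
    (forall f, `|S f| <= A * `|f|) /\ (forall f, `|f| <= B * `|S f|).
Proof.
move=> [v v0] TA TB; pose e := `|v|^-1 *: v.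
have e1 : `|e| = 1 by rewrite normrZ normfV normr_id mulVf// normr_eq0.
have ec (f : Cspace cK1 R^o) : continuous (fun x => f x *: e : E1).
  by move=> x; apply: cvgZr_tmp; exact: cspace_continuous.
(* Multiplication by the unit vector [e] is a linear isometry, so composing with it preserves both
   bounds. *)
pose tensor f : Cspace cK1 E1 := cspace_of cK1 (ec f).
have tensor_lin : linear tensor.
  move=> k f g; apply/val_inj/funext => x.
  by rewrite /= [LHS]scalerDl -scalerA.
have tensorE f : `|tensor f| = `|f|.
  apply/eqP; rewrite eq_le; apply/andP; split; apply: supnorm_le => // x.
    by rewrite /= normrZ e1 mulr1; exact: supnorm_ub.
  apply: le_trans (supnorm_ub (tensor f) x).
  by rewrite /= normrZ e1 mulr1.
have S_lin : linear (T \o tensor).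
  by move=> k f g; rewrite /= tensor_lin linearP.
exists (HB.pack_for {linear Cspace cK1 R^o -> Cspace cK2 E2} (T \o tensor)
  (GRing.isLinear.Build R _ _ *:%R _ S_lin)).
by split=> f; rewrite -tensorE; [exact: TA|exact: TB].
Qed.

Lemma ler_limit_eps (R : realFieldType) (x y c : R) : 0 <= c ->
  (forall eps, 0 < eps -> x <= y + c * eps) -> x <= y.
Proof.
move=> c0 xy; apply/ler_addgt0Pr => e e0.
(* Dividing by [c + 1] instead of [c] covers [c = 0]. *)
have c1 : 0 < c + 1 by rewrite ltr_wpDl.
apply: (le_trans (xy (e / (c + 1)) _)); first by rewrite divr_gt0.
by rewrite lerD2l mulrCA ger_pMr// ler_pdivrMr// mul1r lerDl.
Qed.

(** An infinite compact space has an accumulation point. This makes the denominator [k - 1] of the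
    linear bound positive. *)
Lemma infinite_height_gt1 (K : topologicalType) k : compact [set: K] ->
  infinite_set [set: K] -> cantor_bendixson K k = set0 -> (1 < k)%N.
Proof.
move=> cK infK Kk; rewrite ltnNge; apply/negP => k1.
have [x xlim] := compact_infinite_limit_point cK infK.
have : cantor_bendixson K k x by apply: (sub_cantor_bendixson k1); split.
by rewrite Kk.
Qed.

(** * Distortion of embeddings and comparison of heights *)

Section distortion.
Context (R : realType) (K1 K2 : topologicalType)
  (hK1 : hausdorff_space K1) (hK2 : hausdorff_space K2)
  (cK1 : compact [set: K1]) (cK2 : compact [set: K2])
  (infK2 : infinite_set [set: K2]) (E1 E2 : normedModType R)
  (E1_neq0 : exists x : E1, x != 0)
  (E2_c0 : ~ embeds_isomorphically (c0_space R) E2)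
  (T : {linear Cspace cK1 E1 -> Cspace cK2 E2}) (Tiso : into_isomorphism T)
  (k : nat) (K2k : cantor_bendixson K2 k = set0).
Local Notation A := (opnorm T).
Local Notation B := (inverse_norm T).

Let A0 : 0 <= A. Proof. exact: opnorm_on_ge0. Qed.
Let B0 : 0 <= B. Proof. exact: opnorm_on_ge0. Qed.

Let S_ : exists S : {linear Cspace cK1 R^o -> Cspace cK2 E2},
  (forall f, `|S f| <= A * `|f|) /\ (forall f, `|f| <= B * `|S f|).
Proof.
apply: (scalar_restriction E1_neq0) => f; last exact: inverse_norm_ge.
by apply: opnorm_ge; have [] := Tiso.
Qed.

Lemma distortion_ge3 : cantor_bendixson K1 k !=set0 -> 3 <= A * B.
Proof.
move=> [x xk]; have [S [SA SB]] := S_.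
apply: (@ler_limit_eps _ _ _ (B * 2)) => [|eps eps0]; first by rewrite mulr_ge0.
have k1 := infinite_height_gt1 cK2 infK2 K2k.
have := three_le_distortion hK1 hK2 E2_c0 A0 SA eps0 B0 SB k1 K2k xk.
by rewrite mulrDr mulrA (mulrC B A).
Qed.

(** Here [n.+1] stands for l. Stated for one nonempty derived set, the bound serves the first claim
    with [n = l - 1] and the second with arbitrarily large [n]. *)
Lemma distortion_ge_linear n : (k <= n)%N -> cantor_bendixson K1 n !=set0 ->
  (2 * n.+1%:R - k%:R - 1) / (k%:R - 1) <= A * B.
Proof.
move=> kn [x xn]; have [S [SA SB]] := S_.
have := infinite_height_gt1 cK2 infK2 K2k.
case: k K2k kn => [//|m] K2m mn; rewrite ltnS => m0.
have m0R : 0 < m%:R :> R by rewrite ltr0n.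
have -> : m.+1%:R - 1 = m%:R :> R by rewrite -natr1 addrK.
rewrite ler_pdivrMr//.
apply: (@ler_limit_eps _ _ _ (B * (m%:R + 2 * n%:R))) => [|eps eps0].
  by rewrite mulr_ge0// addr_ge0// mulr_ge0.
have := linear_le_distortion hK1 hK2 E2_c0 A0 SA eps0 B0 SB (ltnW mn) K2m xn.
have -> : (m + 2 * (n - m))%:R = 2 * n.+1%:R - m.+1%:R - 1 :> R.
  by rewrite natrD natrM (natrB _ (ltnW mn)) -!natr1; ring.
by move=> /le_trans; apply; rewrite le_eqVlt; apply/orP; left; apply/eqP; ring.
Qed.

End distortion.

Theorem corollary1p5 (R : realType) (K1 K2 : topologicalType)
    (hK1 : hausdorff_space K1) (hK2 : hausdorff_space K2)
    (cK1 : compact [set: K1]) (cK2 : compact [set: K2])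
    (infK1 : infinite_set [set: K1]) (infK2 : infinite_set [set: K2])
    (E1 E2 : completeNormedModType R)
    (E1_neq0 : exists x : E1, x != 0) (E2_neq0 : exists x : E2, x != 0)
    (E2_c0 : ~ embeds_isomorphically (c0_space R) E2) :
  (forall l k : nat, (k < l)%N -> has_height K1 l -> has_height K2 k ->
     forall T : {linear Cspace cK1 E1 -> Cspace cK2 E2},
     into_isomorphism T ->
     opnorm T * inverse_norm T >=
       Num.max 3 ((2 * l%:R - k%:R - 1) / (k%:R - 1)))
  /\
  (embeds_isomorphically (Cspace cK1 E1) (Cspace cK2 E2) ->
   finite_height K2 -> finite_height K1).
Proof.
split.
  move=> l k kl [_ K1l] [K2k _] T Tiso.
  rewrite ge_max (distortion_ge3 hK1 hK2 infK2 E1_neq0 E2_c0 Tiso K2k (K1l _ kl)).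
  case: l kl K1l => // n kn K1n.
  exact: (distortion_ge_linear hK1 hK2 infK2 E1_neq0 E2_c0 Tiso K2k kn (K1n _ _)).
move=> [T Tiso] [k K2k]; apply: contrapT => /forallNP K1_neq0.
have k1 := infinite_height_gt1 cK2 infK2 K2k.
have k1R : 0 < k%:R - 1 :> R by rewrite subr_gt0 ltr1n.
pose M := opnorm T * inverse_norm T.
(* For this [n] the linear lower bound exceeds the distortion [M] of [T]; the maximum with [k]
   secures [k <= n]. *)
pose n := maxn k (Num.bound (M * (k%:R - 1) + k%:R)).
have K1n : cantor_bendixson K1 n !=set0 by apply/set0P/eqP; exact: K1_neq0.
have := distortion_ge_linear hK1 hK2 infK2 E1_neq0 E2_c0 Tiso K2k (leq_maxl _ _) K1n.
apply/negP; rewrite -ltNge ltr_pdivlMr// -/M -/n.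
have M0 : 0 <= M by rewrite mulr_ge0// opnorm_on_ge0.
have : M * (k%:R - 1) + k%:R < n%:R.
  apply: lt_le_trans (archi_boundP _) _; last by rewrite ler_nat leq_maxr.
  by rewrite addr_ge0// mulr_ge0// ltW.
by rewrite -natr1; have : 0 <= n%:R :> R by []; lra.
Qed.
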